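(* Let $\mathcal M=(\mathcal D,\mathrm x)$ be a minimal time-like surface in $\mathbb R^n_1$ given in isothermal coordinates $(u,v)\in\mathcal D$ (with $E<0$), and let $\Phi=\mathrm x_u+\mathrm j\,\mathrm x_v$. Then the Gauss curvature $K$ of $\mathcal M$ is given by $$K=-\frac{4\|\Phi'^{\bot}\|^2}{\|\Phi\|^4}\qquad\text{and}\qquad K=-\frac{4\|\Phi\wedge\Phi'\|^2}{\|\Phi\|^6}.$$
   Context: $\mathbb D=\{t=u+\mathrm j v:\ u,v\in\mathbb R\}$ with $\mathrm j^2=1$ is the algebra of double numbers; $\bar t=u-\mathrm jv$, $|t|^2=t\bar t$; $\frac{\partial}{\partial t}=\frac12\left(\frac{\partial}{\partial u}+\mathrm j\frac{\partial}{\partial v}\right)$. $\mathbb R^n_1$ is $\mathbb R^n$ with $a\cdot b=-a_1b_1+a_2b_2+\dots+a_nb_n$; $\mathbb D^n_1=\mathbb D^n$ with the $\mathbb D$-bilinear extension of this product; for $a\in\mathbb D^n_1$, $a^2=a\cdot a$, $\|a\|^2=a\cdot\bar a\in\mathbb R$, $\|a\|^4=(\|a\|^2)^2$, $\|a\|^6=(\|a\|^2)^3$. For $a,b\in\mathbb D^n_1$ the norm of the bivector $a\wedge b$ is $\|a\wedge b\|^2=\|a\|^2\|b\|^2-|\bar a\cdot b|^2$. A time-like surface $\mathcal M=(\mathcal D,\mathrm x)$ is given by a smooth immersion $\mathrm x(u,v):\mathcal D\to\mathbb R^n_1$ of a domain $\mathcal D\subset\mathbb R^2\cong\mathbb D$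 ($t=u+\mathrm jv$) whose induced metric is indefinite. With $E=\mathrm x_u^2$, $F=\mathrm x_u\cdot\mathrm x_v$, $G=\mathrm x_v^2$, the coordinates are isothermal if $E=-G$, $F=0$; the standing convention is $E<0$. $\Phi'=\frac{\partial\Phi}{\partial t}$, and $a^\bot$ is the orthogonal projection of $a\in\mathbb D^n_1$ to the $\mathbb D$-linear span of the normal space $N_p(\mathcal M)$. The second fundamental form is $\sigma(X,Y)=(\nabla_XY)^\bot$ with $\nabla$ the canonical flat connection. For an orthonormal tangent basis with $X_1^2=-1$, $X_2^2=1$: $\mathrm H=\frac12(-\sigma(X_1,X_1)+\sigma(X_2,X_2))$ and $K=-R(X_1,X_2)X_2\cdot X_1=-\sigma(X_1,X_1)\cdot\sigma(X_2,X_2)+\sigma^2(X_1,X_2)$, where $R(X,Y)Z=\nabla^T_X\nabla^T_YZ-\nabla^T_Y\nabla^T_XZ-\nabla^T_{[X,Y]}Z$ is the curvature tensor of the Levi-Civita connection $\nabla^T$ of $\mathcal M$. The surface is minimal if $\mathrm H=0$ everywhere. *)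

(* Defs.v *)
From HB Require Import structures.
From mathcomp Require Import all_boot all_order all_algebra ring.
From mathcomp Require Import all_classical all_reals all_analysis.

Set Implicit Arguments.
Unset Strict Implicit.
Unset Printing Implicit Defensive.

Import Order.TTheory GRing.Theory Num.Theory.
Import numFieldNormedType.Exports.

Local Open Scope classical_set_scope.
Local Open Scope ring_scope.

Record dnum (R : Type) := Double { dRe : R; dIm : R }.
Arguments Double {R}.

Definition dnum_pair (R : Type) (t : dnum R) : R * R := (dRe t, dIm t).
Definition pair_dnum (R : Type) (p : R * R) : dnum R := Double p.1 p.2.

Lemma dnum_pairK (R : Type) : cancel (@dnum_pair R) (@pair_dnum R).
Proof. by case. Qed.

HB.instance Definition _ (R : choiceType) :=
  Choice.copy (dnum R) (can_type (@dnum_pairK R)).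

Section DoubleRing.
Variable R : comNzRingType.
Implicit Types s t : dnum R.

Definition dnum_add s t := Double (dRe s + dRe t) (dIm s + dIm t).
Definition dnum_opp t := Double (- dRe t) (- dIm t).
(* (a + j b) (c + j d) with j ^+ 2 = 1 *)
Definition dnum_mul s t :=
  Double (dRe s * dRe t + dIm s * dIm t) (dRe s * dIm t + dIm s * dRe t).

Lemma dnum_addA : associative dnum_add.
Proof. by move=> [a b] [c d] [e f]; rewrite /dnum_add /= !addrA. Qed.
Lemma dnum_addC : commutative dnum_add.
Proof. by move=> [a b] [c d]; rewrite /dnum_add /= addrC (addrC b). Qed.
Lemma dnum_add0 : left_id (Double 0 0) dnum_add.
Proof. by move=> [a b]; rewrite /dnum_add /= !add0r. Qed.
Lemma dnum_addN : left_inverse (Double 0 0) dnum_opp dnum_add.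
Proof. by move=> [a b]; rewrite /dnum_add /= !addNr. Qed.

HB.instance Definition _ := GRing.isZmodule.Build (dnum R)
  dnum_addA dnum_addC dnum_add0 dnum_addN.

Lemma dnum_mulA : associative dnum_mul.
Proof. by move=> [a b] [c d] [e f]; rewrite /dnum_mul /=; congr Double; ring. Qed.
Lemma dnum_mulC : commutative dnum_mul.
Proof. by move=> [a b] [c d]; rewrite /dnum_mul /=; congr Double; ring. Qed.
Lemma dnum_mul1 : left_id (Double 1 0) dnum_mul.
Proof. by move=> [a b]; rewrite /dnum_mul /=; congr Double; ring. Qed.
Lemma dnum_mulD : left_distributive dnum_mul dnum_add.
Proof.
by move=> [a b] [c d] [e f]; rewrite /dnum_mul /dnum_add /=; congr Double; ring.
Qed.
Lemma dnum_oner_neq0 : Double 1 0 != 0 :> dnum R.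
Proof. by apply/eqP => -[] /eqP; rewrite oner_eq0. Qed.

HB.instance Definition _ := GRing.Zmodule_isComNzRing.Build (dnum R)
  dnum_mulA dnum_mulC dnum_mul1 dnum_mulD dnum_oner_neq0.

Definition dreal (a : R) : dnum R := Double a 0.
Definition dj : dnum R := Double 0 1.
Definition dconj t : dnum R := Double (dRe t) (- dIm t).

(* |t|^2 = t * conj t is a real number, possibly negative. *)
Definition dabs2 t : R := dRe (t * dconj t).

Lemma dabs2E t : dreal (dabs2 t) = t * dconj t.
Proof.
by case: t => a b; rewrite /dreal /dabs2 /GRing.mul /= /dnum_mul /=;
  congr Double; ring.
Qed.

End DoubleRing.

Arguments dj {R}.

(* The product of R^n_1 (A real) and its bilinear extension to D^n_1
   (A = dnum R): the coordinate of index 0 carries the minus sign. *)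
Definition mdot (A : comNzRingType) (n : nat) (a b : 'rV[A]_n) : A :=
  \sum_(i < n) (if val i == 0%N then - (a 0 i * b 0 i) else a 0 i * b 0 i).

Definition lin_span (A : nzRingType) (V : lmodType A) (S : set V) : set V :=
  [set w | exists k (c : 'I_k -> A) (s : 'I_k -> V),
     (forall i, S (s i)) /\ w = \sum_(i < k) c i *: s i].

(* The orthogonal projection of a to W (0 if there is none; it exists and is
   unique when mdot is nondegenerate on W). *)
Definition orth_proj (A : comNzRingType) (n : nat) (W : set 'rV[A]_n)
    (a : 'rV[A]_n) : 'rV[A]_n :=
  xget 0 [set b | W b /\ forall w, W w -> mdot (a - b) w = 0].

Section DoubleVectors.
Variables (R : comNzRingType) (n : nat).
Implicit Types a b : 'rV[dnum R]_n.

Definition vreal (w : 'rV[R]_n) : 'rV[dnum R]_n := map_mx (@dreal R) w.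
Definition vconj a : 'rV[dnum R]_n := map_mx (@dconj R) a.
Definition vRe a : 'rV[R]_n := map_mx (@dRe R) a.
Definition vIm a : 'rV[R]_n := map_mx (@dIm R) a.

(* ||a||^2 = a . conj a is a real number, possibly negative. *)
Definition vnorm2 a : R := dRe (mdot a (vconj a)).

Lemma vnorm2E a : dreal (vnorm2 a) = mdot a (vconj a).
Proof.
rewrite /vnorm2; suff : dIm (mdot a (vconj a)) = 0.
  by case: (mdot _ _) => x y /= ->.
rewrite /mdot; elim/big_ind: _ => //= [s t|i _].
  by case: s t => [s1 s2] [t1 t2] /= -> ->; rewrite addr0.
by rewrite mxE; case: (a 0 i) => x y; case: ifP => _ /=; ring.
Qed.

(* The norm ||a /\ b||^2 of the bivector a /\ b, possibly negative. *)
Definition wedge_norm2 a b : R :=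
  vnorm2 a * vnorm2 b - dabs2 (mdot (vconj a) b).

End DoubleVectors.

Section Calculus.
Variables (R : realType) (V : normedModType R).

Definition d_du (f : R * R -> V) : R * R -> V := fun p => 'D_((1, 0) : R * R) f p.
Definition d_dv (f : R * R -> V) : R * R -> V := fun p => 'D_((0, 1) : R * R) f p.

Fixpoint Ck (k : nat) (U : set (R * R)) (f : R * R -> V) : Prop :=
  match k with
  | 0%N => forall p, U p -> {for p, continuous f}
  | k'.+1 => [/\ forall p, U p -> differentiable f p,
                 Ck k' U (d_du f) & Ck k' U (d_dv f)]
  end.

Definition smooth (U : set (R * R)) (f : R * R -> V) : Prop :=
  forall k, Ck k U f.

End Calculus.

Definition domain (R : realType) (D : set (R * R)) : Prop :=
  [/\ open D, connected D & D !=set0].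

Section Surface.
Variables (R : realType) (n : nat).
(* A surface is parametrized by x on a subset of the (u, v)-plane. Its tangent
   vector fields are given by their (u, v)-components X : R * R -> R * R; the
   tangent vector of R^n_1 at the parameter q is push X q. *)
Variable x : R * R -> 'rV[R]_n.
Implicit Types (X Y Z : R * R -> R * R) (p q : R * R).

Definition metricE p : R := mdot (d_du x p) (d_du x p).
Definition metricF p : R := mdot (d_du x p) (d_dv x p).
Definition metricG p : R := mdot (d_dv x p) (d_dv x p).

Definition immersion (D : set (R * R)) : Prop :=
  forall p, D p -> injective ('d x p : R * R -> 'rV[R]_n).

Definition indefinite_metric (D : set (R * R)) : Prop :=
  forall p, D p -> exists w w' : R * R,
    mdot ('d x p w) ('d x p w) < 0 /\ 0 < mdot ('d x p w') ('d x p w').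

Definition timelike_surface (D : set (R * R)) : Prop :=
  [/\ domain D, smooth D x, immersion D & indefinite_metric D].

Definition isothermal (D : set (R * R)) : Prop :=
  forall p, D p -> metricE p = - metricG p /\ metricF p = 0.

Definition tangent_space p : set 'rV[R]_n := range ('d x p : R * R -> 'rV[R]_n).

Definition normal_space p : set 'rV[R]_n :=
  [set w | forall t, tangent_space p t -> mdot w t = 0].

Definition dnormal_proj p (a : 'rV[dnum R]_n) : 'rV[dnum R]_n :=
  orth_proj (lin_span (@vreal R n @` normal_space p)) a.

Definition push X : R * R -> 'rV[R]_n := fun q => 'd x q (X q).

(* The flat connection of R^n_1 on fields along the surface, and its tangential
   part, the Levi-Civita connection. *)
Definition nabla X (W : R * R -> 'rV[R]_n) : R * R -> 'rV[R]_n :=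
  fun q => 'D_(X q) W q.
Definition nablaT X (W : R * R -> 'rV[R]_n) : R * R -> 'rV[R]_n :=
  fun q => orth_proj (tangent_space q) (nabla X W q).

Definition second_form X Y : R * R -> 'rV[R]_n :=
  fun q => orth_proj (normal_space q) (nabla X (push Y) q).

Definition lie_bracket X Y : R * R -> R * R :=
  fun q => 'D_(X q) Y q - 'D_(Y q) X q.

Definition curvature X Y Z : R * R -> 'rV[R]_n := fun q =>
  nablaT X (nablaT Y (push Z)) q - nablaT Y (nablaT X (push Z)) q
  - nablaT (lie_bracket X Y) (push Z) q.

Definition orthonormal_frame (U : set (R * R)) X1 X2 : Prop :=
  [/\ smooth U X1, smooth U X2 & forall q, U q ->
      [/\ mdot (push X1 q) (push X1 q) = -1,
          mdot (push X2 q) (push X2 q) = 1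
        & mdot (push X1 q) (push X2 q) = 0]].

Definition local_frame p X1 X2 : Prop :=
  exists U : set (R * R), [/\ open U, U p & orthonormal_frame U X1 X2].

(* The vector H and the number K at p do not depend on the frame: xget selects
   the common value over all the smooth orthonormal frames near p. *)
Definition mean_curvature p : 'rV[R]_n :=
  xget 0 [set h | exists X1 X2, local_frame p X1 X2 /\
    h = 2^-1 *: (- second_form X1 X1 p + second_form X2 X2 p)].

Definition gauss_curvature p : R :=
  xget 0 [set k | exists X1 X2, local_frame p X1 X2 /\
    k = - mdot (curvature X1 X2 X2 p) (push X1 p)].

Definition minimal (D : set (R * R)) : Prop :=
  forall p, D p -> mean_curvature p = 0.

Definition Phi : R * R -> 'rV[dnum R]_n :=
  fun p => vreal (d_du x p) + dj *: vreal (d_dv x p).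

End Surface.

Section DoubleDerivative.
Variables (R : realType) (n : nat).

(* Derivatives of D^n-valued functions are taken on the real and j-parts. *)
Definition d_du_dnum (f : R * R -> 'rV[dnum R]_n) : R * R -> 'rV[dnum R]_n :=
  fun p => vreal (d_du (fun q => vRe (f q)) p) + dj *: vreal (d_du (fun q => vIm (f q)) p).
Definition d_dv_dnum (f : R * R -> 'rV[dnum R]_n) : R * R -> 'rV[dnum R]_n :=
  fun p => vreal (d_dv (fun q => vRe (f q)) p) + dj *: vreal (d_dv (fun q => vIm (f q)) p).

Definition d_dt (f : R * R -> 'rV[dnum R]_n) : R * R -> 'rV[dnum R]_n :=
  fun p => dreal 2^-1 *: (d_du_dnum f p + dj *: d_dv_dnum f p).

End DoubleDerivative.

(* Main.v *)
From HB Require Import structures.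
Require Import Defs.
From mathcomp Require Import all_boot all_order all_algebra ring.
From mathcomp Require Import all_classical all_reals all_analysis.

Import Order.TTheory GRing.Theory Num.Theory.
Import numFieldNormedType.Exports.

Set Implicit Arguments.
Unset Strict Implicit.
Unset Printing Implicit Defensive.

Local Open Scope classical_set_scope.
Local Open Scope ring_scope.

(* Write ^N for the normal part. The Gauss equation, obtained for arbitrary smooth
   fields by differentiating (nabla_Y Z)^T . W = nabla_Y Z . W, turns K into
   - sigma(X1, X1) . sigma(X2, X2) + sigma(X1, X2)^2. In isothermal coordinates
   every orthonormal frame has the components X1 = (a, b), X2 = k (b, a) with
   k^2 = 1 and E (a^2 - b^2) = -1, so that minimality reads x_uu^N = x_vv^N and
   K = ((x_uv^N)^2 - (x_uu^N)^2) / E^2. On the other hand Phi'^N = x_uu^N + j x_uv^N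
   and ||Phi||^2 = 2 E. Finally Phi^2 = 0 gives Phi . Phi' = 0, so the tangent part
   of Phi' is proportional to Phi and ||Phi /\ Phi'||^2 = ||Phi||^2 ||Phi'^N||^2. *)

(** * Symmetry of second derivatives *)

(** Projections, mean curvature and Gauss curvature are all selected by [xget] with default [0], and
    this shapes the proof. A projection needs existence and uniqueness: [tan_part] gives it
    explicitly, dividing only by E, and the normal part is the remainder, so no basis of the normal
    space is ever chosen. For H and K one frame is exhibited, which excludes the default, and the
    value is then computed for whichever frame [xget] returned; hence arbitrary frames, with their
    undetermined sign k, are carried along. The curvature differentiates projected fields, so these
    must be shown smooth near the point, and an equality passes through a derivative only when it
    holds on an open set. Symmetry of mixed partials enters twice: it makes the ambient connection
    flat, and it gives the derivative of x_v along u as x_uv. *)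

Section NearEq.
Variables (R : numFieldType) (V W : normedModType R).

(** The first-order expansion of [f] at [a] is also one of [g], because the little-o only sees
    points near [a]; [diff_unique] then identifies the differential. *)
Lemma near_eq_differentiable (f g : V -> W) (a : V) :
  (\near a, f a = g a) -> differentiable f a -> differentiable g a.
Proof.
move=> fg df; have fga : f a = g a := nbhs_singleton fg.
have key : g \o shift a = cst (g a) + 'd f a +o_ 0 id.
  apply/eqaddoP => _/posnumP[e].
  have /eqaddoP /(_ e%:num (gt0 _)) := diff_locally df.
  move=> fo; near=> h; have -> : (g \o shift a - (cst (g a) + 'd f a)) h =
      (f \o shift a - (cst (f a) + 'd f a)) h.
    rewrite !fctE /= -fga; congr (_ - _); apply: esym.
    near: h; rewrite near_simpl.
    by move: fg; rewrite (near_shift 0 a) /= subr0.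
  by near: h.
have df_g : 'd g a = 'd f a :> (V -> W).
  by apply: diff_unique => //; exact: diff_continuous.
by apply/diff_locallyP; rewrite df_g; split=> //; exact: diff_continuous.
Unshelve. all: by end_near. Qed.

End NearEq.

Section Line.
Variables (R : realType) (V : normedModType R).
Implicit Types (f : V -> R) (c v w : V).

Lemma is_derive_line f c v (s : R) : derivable f (c + s *: v) v ->
  is_derive s 1 (fun r : R => f (c + r *: v)) ('D_v f (c + s *: v)).
Proof.
move=> df; have E : (fun h : R => h^-1 *: (f (c + (h *: (1 : R) + s) *: v)
    - f (c + s *: v))) =
  (fun h => h^-1 *: (f (h *: v + (c + s *: v)) - f (c + s *: v))).
  apply/funext => h; congr (_ *: (f _ - _)).
  by rewrite scalerDl /GRing.scale /= mulr1 addrCA.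
by split; rewrite /derivable /derive /= E.
Qed.

(* The mean value theorem applied first to
   s |-> f (c + s v + h w) - f (c + s v), then to t |-> 'D_v f (c + s v + t w). *)
Lemma second_difference f c v w (h : R) : 0 < h ->
  (forall s t, 0 <= s <= h -> 0 <= t <= h ->
     derivable f (c + s *: v + t *: w) v /\
     derivable ('D_v f) (c + s *: v + t *: w) w) ->
  exists s t, [/\ 0 <= s <= h, 0 <= t <= h &
    f (c + h *: v + h *: w) - f (c + h *: v) - (f (c + h *: w) - f c) =
    'D_w ('D_v f) (c + s *: v + t *: w) * h * h].
Proof.
move=> h0 df.
have hh : 0 <= h <= h by rewrite lexx ltW.
have h00 : 0 <= (0 : R) <= h by rewrite lexx ltW.
pose phi s := f (c + h *: w + s *: v) - f (c + s *: v).
pose dphi s := 'D_v f (c + h *: w + s *: v) - 'D_v f (c + s *: v).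
have dphiP s : 0 <= s <= h -> is_derive s 1 phi (dphi s).
  move=> sh; apply: is_deriveB.
    by apply: is_derive_line; rewrite addrAC; exact: (df s h sh hh).1.
  by apply: is_derive_line; have := (df s 0 sh h00).1; rewrite scale0r addr0.
have itvP' (a : R) : a \in `[0, h] -> 0 <= a <= h by rewrite in_itv.
have [s /itvP' sh] : exists2 s, s \in `[0, h] & phi h - phi 0 = dphi s * (h - 0).
  apply: (@MVT_segment _ phi dphi 0 h (ltW h0)).
    by move=> r; rewrite in_itv /= => /andP[r0 rh]; apply: dphiP; rewrite !ltW.
  apply: derivable_within_continuous => r /itvP' rh.
  by have [] := dphiP r rh.
pose psi t := 'D_v f (c + s *: v + t *: w).
have dpsi t : 0 <= t <= h ->
    is_derive t 1 psi ('D_w ('D_v f) (c + s *: v + t *: w)).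
  by move=> th; apply: (is_derive_line (f := 'D_v f)); exact: (df s t sh th).2.
have [t /itvP' th] : exists2 t, t \in `[0, h] &
    psi h - psi 0 = 'D_w ('D_v f) (c + s *: v + t *: w) * (h - 0).
  apply: (@MVT_segment _ psi _ 0 h (ltW h0)).
    by move=> r; rewrite in_itv /= => /andP[r0 rh]; apply: dpsi; rewrite !ltW.
  apply: derivable_within_continuous => r /itvP' rh.
  by have [] := dpsi r rh.
rewrite subr0 /psi scale0r addr0 => psiE.
rewrite /dphi (addrAC c) psiE /phi scale0r !addr0 (addrAC c) => phiE.
by exists s, t; split.
Qed.

(** The second difference over the parallelogram spanned by h v and h w is symmetric in v and w, so
    the two mixed derivatives share a value at points near p. With [e] half of their gap at p,
    continuity makes the gap smaller than 2 e, a contradiction. *)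
Lemma derive_comm f (U : set V) p v w : open U -> U p ->
  (forall q, U q -> [/\ derivable f q v, derivable f q w,
     derivable ('D_v f) q w & derivable ('D_w f) q v]) ->
  {for p, continuous ('D_w ('D_v f))} -> {for p, continuous ('D_v ('D_w f))} ->
  'D_w ('D_v f) p = 'D_v ('D_w f) p.
Proof.
move=> oU Up df cwv cvw; apply/eqP; rewrite -subr_eq0 -normr_eq0.
apply/negP => /negP; rewrite normr_eq0 => ne.
pose e := `|'D_w ('D_v f) p - 'D_v ('D_w f) p| / 2.
have e0 : 0 < e by rewrite divr_gt0 // normr_gt0.
have nU : \forall q \near p, U q by exact: open_nbhs_nbhs.
have n1 : \forall q \near p, `|'D_w ('D_v f) p - 'D_w ('D_v f) q| < e.
  by move/cvgrPdist_lt : cwv; apply.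
have n2 : \forall q \near p, `|'D_v ('D_w f) p - 'D_v ('D_w f) q| < e.
  by move/cvgrPdist_lt : cvw; apply.
have /nbhs_normP[/= r r0 rP] : \forall q \near p, [/\ U q,
    `|'D_w ('D_v f) p - 'D_w ('D_v f) q| < e &
    `|'D_v ('D_w f) p - 'D_v ('D_w f) q| < e].
  by move: nU n1 n2; apply: filterS3 => q; split.
pose k := `|v| + `|w| + 1.
have k0 : 0 < k by rewrite /k ltr_wpDl // addr_ge0.
(* For s, t in [0, h] the vector s v + t w has norm at most h k = r / 2, so the whole box stays in
   the ball; the summand 1 in [k] keeps the divisor positive. *)
pose h := r / 2 / k.
have h0 : 0 < h by rewrite !divr_gt0.
have box s t : 0 <= s <= h -> 0 <= t <= h -> `|p - (p + s *: v + t *: w)| < r.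
  move=> /andP[s0 sh] /andP[t0 th].
  rewrite -addrA opprD addrA subrr sub0r normrN.
  apply: (le_lt_trans (ler_normD _ _)); rewrite !normrZ !ger0_norm //.
  apply: (@le_lt_trans _ _ (h * k)).
    rewrite /k 2!mulrDr -[leLHS]addr0; apply: lerD; last by rewrite mulr1 ltW.
    by apply: lerD; exact: ler_wpM2r.
  by rewrite /h divfK ?gt_eqF // ltr_pdivrMr // ltr_pMr // ltr1n.
have [s [t [sh th E1]]] : exists s t, [/\ 0 <= s <= h, 0 <= t <= h &
    f (p + h *: v + h *: w) - f (p + h *: v) - (f (p + h *: w) - f p) =
    'D_w ('D_v f) (p + s *: v + t *: w) * h * h].
  apply: (second_difference h0) => s t sh th.
  have [Uq _ _] := rP _ (box s t sh th); have [d1 _ d2 _] := df _ Uq.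
  exact: conj d1 d2.
have [t' [s' [th' sh' E2]]] : exists s t, [/\ 0 <= s <= h, 0 <= t <= h &
    f (p + h *: w + h *: v) - f (p + h *: w) - (f (p + h *: v) - f p) =
    'D_v ('D_w f) (p + s *: w + t *: v) * h * h].
  apply: (second_difference h0) => t' s' th' sh'; rewrite addrAC.
  have [Uq _ _] := rP _ (box s' t' sh' th'); have [_ d1 _ d2] := df _ Uq.
  exact: conj d1 d2.
have E : 'D_w ('D_v f) (p + s *: v + t *: w) =
         'D_v ('D_w f) (p + t' *: w + s' *: v).
  have hn0 : h != 0 by rewrite gt_eqF.
  apply: (mulIf hn0); apply: (mulIf hn0); apply: etrans (esym E1) _.
  apply: etrans E2; rewrite (addrAC p) !opprB addrACA [RHS]addrACA [f _ + f _]addrC.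
  by congr (_ + _); rewrite addrC.
have [_ B1 _] := rP _ (box s t sh th).
have [_ _ B2] := rP _ (box s' t' sh' th').
rewrite addrAC -E distrC in B2.
have := ler_normD ('D_w ('D_v f) p - 'D_w ('D_v f) (p + s *: v + t *: w))
   ('D_w ('D_v f) (p + s *: v + t *: w) - 'D_v ('D_w f) p).
rewrite addrA subrK => B; have := le_lt_trans B (ltrD B1 B2).
by rewrite /e -splitr ltxx.
Qed.

End Line.

(** * Calculus of C^k functions on the plane *)

Section DeriveRules.
Variables (R : realType) (U V W : normedModType R).

Lemma derive_linear (L : {linear V -> W}) (f : U -> V) p v : continuous L ->
  differentiable f p ->
  differentiable (L \o f) p /\ 'D_v (L \o f) p = L ('D_v f p).
Proof.
move=> cL df; have dL := linear_differentiable (f p) cL.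
split; first exact: differentiable_comp.
rewrite deriveE; last exact: differentiable_comp.
by rewrite diff_comp //= diff_lin // -deriveE.
Qed.

Lemma scaler_is_bilinear :
  bilinear_for
    (GRing.Scale.Law.clone _ _ *:%R _) (GRing.Scale.Law.clone _ _ *:%R _)
    (@GRing.scale R V).
Proof.
split=> [u'|u] a x y /=; first by rewrite scalerDl scalerA.
by rewrite scalerDr !scalerA mulrC.
Qed.

Lemma derive_scale (z : U -> R) (f : U -> V) p v :
  differentiable z p -> differentiable f p ->
  differentiable (fun q => z q *: f q) p /\
  'D_v (fun q => z q *: f q) p = z p *: 'D_v f p + 'D_v z p *: f p.
Proof.
move=> dz df.
(* The product rule is obtained as the chain rule through scaling, seen as a continuous bilinear
   map. *)
pose b : {bilinear R -> V -> V} := HB.pack (@GRing.scale R V)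
  (bilinear_isBilinear.Build R R V V _ _ _ scaler_is_bilinear).
have cb : continuous (fun q : R * V => b q.1 q.2).
  by move=> q; exact: scale_continuous.
have dzf : differentiable (fun q => (z q, f q)) p by exact: differentiable_pair.
have E : (fun q => z q *: f q) = (fun q : R * V => b q.1 q.2) \o (fun q => (z q, f q)).
  by [].
have db : differentiable (fun q : R * V => b q.1 q.2) (z p, f p).
  exact: differentiable_bilin.
split; first by rewrite E; exact: differentiable_comp.
rewrite E deriveE; last exact: differentiable_comp.
rewrite diff_comp // (diff_bilin (z p, f p) cb) /= (diff_pair dz df) /=.
by rewrite -!deriveE.
Qed.

Lemma derive_prod (f : R * R -> V) p w : differentiable f p ->
  'D_w f p = w.1 *: d_du f p + w.2 *: d_dv f p.
Proof.
move=> df; rewrite /d_du /d_dv !deriveE // -!linearZ -linearD.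
by congr ('d f p _); case: w => a b; congr (_, _) => /=;
  rewrite /GRing.scale /= mulr1 mulr0 ?addr0 ?add0r.
Qed.

End DeriveRules.

Section Ck.
Variable R : realType.
Implicit Types (U : set (R * R)) (k : nat).

Lemma open_near_eq (T : Type) U (f g : R * R -> T) q : open U -> U q ->
  (forall q, U q -> f q = g q) -> \near q, f q = g q.
Proof. by move=> oU Uq fg; apply: filterS fg _; exact: open_nbhs_nbhs. Qed.

(** Openness lets an equality on [U] hold near each point, hence pass to partial derivatives. The
    rules below for sums, products and inverses rely on it, since their derivative formulas are
    valid on [U] only. *)
Lemma Ck_eq (V : normedModType R) U k (f g : R * R -> V) : open U ->
  (forall q, U q -> f q = g q) -> Ck k U f -> Ck k U g.
Proof.
move=> oU; elim: k f g => [|k IH] f g fg /=.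
  move=> cf p Up; have fgp := open_near_eq oU Up fg.
  change (g x @[x --> p] --> g p); rewrite -(fg _ Up).
  apply: cvg_trans (cf p Up).
  by apply: near_eq_cvg.
move=> [df fu fv]; split.
- move=> p Up; exact: near_eq_differentiable (open_near_eq oU Up fg) (df p Up).
- apply: IH fu => q Uq; apply: near_eq_derive; exact: open_near_eq Uq fg.
- apply: IH fv => q Uq; apply: near_eq_derive; exact: open_near_eq Uq fg.
Qed.

Lemma CkW (V : normedModType R) U k (f : R * R -> V) : Ck k.+1 U f -> Ck k U f.
Proof.
elim: k f => [|k IH] f [df fu fv].
  by move=> p Up; apply: differentiable_continuous; exact: df.
split; [exact: df | exact: IH fu | exact: IH fv].
Qed.

Lemma CkS (V : normedModType R) U U' k (f : R * R -> V) :
  U' `<=` U -> Ck k U f -> Ck k U' f.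
Proof.
move=> sU; elim: k f => [|k IH] f /=; first by move=> cf p /sU; exact: cf.
by move=> [df fu fv]; split; [move=> p /sU; exact: df | exact: IH | exact: IH].
Qed.

Lemma Ck_differentiable (V : normedModType R) U k (f : R * R -> V) p :
  Ck k.+1 U f -> U p -> differentiable f p.
Proof. by move=> [df _ _]; exact: df. Qed.

Lemma Ck_cst (V : normedModType R) U k (c : V) : open U -> Ck k U (fun=> c).
Proof.
move=> oU; elim: k c => [|k IH] c /=; first by move=> p _; exact: cst_continuous.
split; first by move=> p _; exact: differentiable_cst.
- by apply: (Ck_eq (f := fun=> 0)) => // q _; rewrite /d_du (derive_cst c).
- by apply: (Ck_eq (f := fun=> 0)) => // q _; rewrite /d_dv (derive_cst c).
Qed.

Lemma Ck_linear (V W : normedModType R) (L : {linear V -> W}) U k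
    (f : R * R -> V) : open U -> continuous L -> Ck k U f -> Ck k U (L \o f).
Proof.
move=> oU cL; elim: k f => [|k IH] f /=.
  by move=> cf p Up; apply: continuous_comp; [exact: cf | exact: cL].
move=> [df fu fv]; split.
- by move=> p Up; have [] := derive_linear 0 cL (df p Up).
- apply: Ck_eq oU _ (IH _ fu) => q Uq /=.
  by have [_] := derive_linear ((1, 0) : R * R) cL (df q Uq).
- apply: Ck_eq oU _ (IH _ fv) => q Uq /=.
  by have [_] := derive_linear ((0, 1) : R * R) cL (df q Uq).
Qed.

Lemma CkD (V : normedModType R) U k (f g : R * R -> V) : open U ->
  Ck k U f -> Ck k U g -> Ck k U (fun q => f q + g q).
Proof.
move=> oU; elim: k f g => [|k IH] f g /=.
  by move=> cf cg p Up; apply: continuousD; [exact: cf | exact: cg].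
move=> [df fu fv] [dg gu gv]; split.
- by move=> p Up; apply: differentiableD; [exact: df | exact: dg].
- apply: Ck_eq oU _ (IH _ _ fu gu) => q Uq; apply: esym.
  by apply: deriveD; apply: diff_derivable; [exact: df | exact: dg].
- apply: Ck_eq oU _ (IH _ _ fv gv) => q Uq; apply: esym.
  by apply: deriveD; apply: diff_derivable; [exact: df | exact: dg].
Qed.

Lemma CkZ (V : normedModType R) U k (z : R * R -> R) (f : R * R -> V) : open U ->
  Ck k U z -> Ck k U f -> Ck k U (fun q => z q *: f q).
Proof.
move=> oU; elim: k z f => [|k IH] z f /=.
  by move=> cz cf p Up; apply: continuousZ; [exact: cz | exact: cf].
(* Each term of the product rule keeps one factor underived, which is needed at order [k]. *)
move=> cz cf; have zk := CkW cz; have fk := CkW cf.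
have [dz zu zv] := cz; have [df fu fv] := cf; split.
- by move=> p Up; have [] := derive_scale 0 (dz p Up) (df p Up).
- apply: Ck_eq oU _ (CkD oU (IH _ _ zk fu) (IH _ _ zu fk)) => q Uq; apply: esym.
  by have [_] := derive_scale ((1, 0) : R * R) (dz q Uq) (df q Uq).
- apply: Ck_eq oU _ (CkD oU (IH _ _ zk fv) (IH _ _ zv fk)) => q Uq; apply: esym.
  by have [_] := derive_scale ((0, 1) : R * R) (dz q Uq) (df q Uq).
Qed.

Lemma CkM U k (f g : R * R -> R) : open U ->
  Ck k U f -> Ck k U g -> Ck k U (fun q => f q * g q).
Proof. by move=> oU fk gk; exact: (CkZ oU fk gk). Qed.

Lemma CkN (V : normedModType R) U k (f : R * R -> V) : open U ->
  Ck k U f -> Ck k U (fun q => - f q).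
Proof.
move=> oU fk; have fkN := CkZ oU (Ck_cst k (- 1 : R) oU) fk.
apply: Ck_eq oU _ fkN => q _ /=.
by rewrite scaleN1r.
Qed.

(** The derivative of f^-1 is - f^-1 f^-1 f', to be shown of one order less, so the induction
    hypothesis for the same [f] suffices. *)
Lemma CkV U k (f : R * R -> R) : open U -> (forall q, U q -> f q != 0) ->
  Ck k U f -> Ck k U (fun q => (f q)^-1).
Proof.
move=> oU f0; elim: k => [|k IH] /=.
  by move=> cf p Up; apply: continuousV; [exact: f0 | exact: cf].
move=> [df fu fv]; have fk : Ck k U f by apply: CkW.
have Vk := IH fk; have VVk := CkN oU (CkM oU Vk Vk); split.
- by move=> p Up; apply: differentiableV; [exact: df | exact: f0].
- apply: Ck_eq oU _ (CkM oU VVk fu) => q Uq; apply: esym; rewrite /d_du.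
  by rewrite deriveV ?f0 //; [rewrite -invfM -expr2 | exact/diff_derivable/df].
- apply: Ck_eq oU _ (CkM oU VVk fv) => q Uq; apply: esym; rewrite /d_dv.
  by rewrite deriveV ?f0 //; [rewrite -invfM -expr2 | exact/diff_derivable/df].
Qed.

Lemma Ck_sum (V : normedModType R) U k (I : Type) (r : seq I)
    (f : I -> R * R -> V) : open U -> (forall i, Ck k U (f i)) ->
  Ck k U (fun q => \sum_(i <- r) f i q).
Proof.
move=> oU fk; elim: r => [|i r IH].
  by apply: Ck_eq oU _ (Ck_cst k 0 oU) => q _; rewrite big_nil.
by apply: Ck_eq oU _ (CkD oU (fk i) IH) => q _; rewrite big_cons.
Qed.

Lemma coord_is_linear n i : linear (fun w : 'rV[R]_n => w 0 i).
Proof. by move=> a u w; rewrite !mxE. Qed.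

Definition coord_linear n i : {linear 'rV[R]_n -> R} := HB.pack
  (fun w : 'rV[R]_n => w 0 i)
  (GRing.isLinear.Build _ _ _ _ _ (@coord_is_linear n i)).
Lemma Ck_fst U k (X : R * R -> R * R) : open U -> Ck k U X ->
  Ck k U (fun q => (X q).1).
Proof. by move=> oU; apply: (Ck_linear (L := fst)) => // q; exact: cvg_fst. Qed.

Lemma Ck_snd U k (X : R * R -> R * R) : open U -> Ck k U X ->
  Ck k U (fun q => (X q).2).
Proof. by move=> oU; apply: (Ck_linear (L := snd)) => // q; exact: cvg_snd. Qed.

Lemma Ck_coord n U k (f : R * R -> 'rV[R]_n) i : open U -> Ck k U f ->
  Ck k U (fun q => f q 0 i).
Proof.
move=> oU; apply: (Ck_linear (L := coord_linear i)) => // q.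
exact: coord_continuous.
Qed.

Lemma Ck_pair U k (f g : R * R -> R) : open U -> Ck k U f -> Ck k U g ->
  Ck k U (fun q => (f q, g q) : R * R).
Proof.
move=> oU; elim: k f g => [|k IH] f g /=.
  move=> cf cg p Up.
  exact: (@cvg_pair _ _ _ _ _ _ _ _ _ f g (cf p Up) (cg p Up)).
have d_pair w q : differentiable f q -> differentiable g q ->
    ('D_w f q, 'D_w g q) = 'D_w (fun q => (f q, g q) : R * R) q.
  move=> df dg; rewrite [RHS]deriveE; last exact: differentiable_pair.
  by rewrite (diff_pair df dg) !deriveE.
move=> [df fu fv] [dg gu gv]; split.
- by move=> p Up; apply: differentiable_pair; [exact: df | exact: dg].
- apply: Ck_eq oU _ (IH _ _ fu gu) => q Uq.
  by apply: d_pair; [exact: df | exact: dg].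
- apply: Ck_eq oU _ (IH _ _ fv gv) => q Uq.
  by apply: d_pair; [exact: df | exact: dg].
Qed.

Lemma derive_fst (X : R * R -> R * R) p v : differentiable X p ->
  ('D_v X p).1 = 'D_v (fun q => (X q).1) p.
Proof.
move=> dX; have [||_ /= ->] := @derive_linear _ _ _ _ fst X p v => //.
by move=> q; exact: cvg_fst.
Qed.

Lemma derive_snd (X : R * R -> R * R) p v : differentiable X p ->
  ('D_v X p).2 = 'D_v (fun q => (X q).2) p.
Proof.
move=> dX; have [||_ /= ->] := @derive_linear _ _ _ _ snd X p v => //.
by move=> q; exact: cvg_snd.
Qed.

Lemma derive_coord n (f : R * R -> 'rV[R]_n) p v i : differentiable f p ->
  ('D_v f p) 0 i = 'D_v (fun q => f q 0 i) p.
Proof.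
move=> df; have [||_ /= ->] := @derive_linear _ _ _ _ (coord_linear i) f p v => //.
by move=> q; exact: coord_continuous.
Qed.

Lemma Ck_mdot n U k (f g : R * R -> 'rV[R]_n) : open U -> Ck k U f -> Ck k U g ->
  Ck k U (fun q => mdot (f q) (g q)).
Proof.
move=> oU fk gk; apply: Ck_sum => // i; have fgk := CkM oU (Ck_coord i oU fk)
  (Ck_coord i oU gk).
case: (val i == 0%N); last exact: fgk.
exact: CkN oU fgk.
Qed.

Lemma derive_mdot n (f g : R * R -> 'rV[R]_n) p v :
  differentiable f p -> differentiable g p ->
  'D_v (fun q => mdot (f q) (g q)) p = mdot ('D_v f p) (g p) + mdot (f p) ('D_v g p).
Proof.
move=> df dg.
have dcoord (h : R * R -> 'rV[R]_n) i : differentiable h p ->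
    derivable (fun q => h q 0 i) p v.
  move=> dh; apply: diff_derivable.
  by have [|] := @derive_linear _ _ _ _ (coord_linear i) h p v _ dh;
    [exact: coord_continuous |].
(* The Lorentzian sign becomes a constant factor, so that all summands are differentiated alike. *)
pose h (i : 'I_n) q := (if val i == 0%N then - 1 else 1) * (f q 0 i * g q 0 i).
have -> : (fun q => mdot (f q) (g q)) = \sum_i h i.
  apply/funext => q; rewrite fct_sumE; apply: eq_bigr => i _; rewrite /h.
  by case: ifP; rewrite ?mulN1r ?mul1r.
have dh i : derivable (fun q => f q 0 i * g q 0 i) p v.
  by apply: derivableM; exact: dcoord.
rewrite derive_sum; last first.
  by move=> i; exact: derivableM (derivable_cst _ _ _) (dh i).
rewrite /mdot -big_split; apply: eq_bigr => i _.
rewrite [LHS](deriveZ _ (dh i)) (deriveM (dcoord f i df) (dcoord g i dg)).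
rewrite !derive_coord // /GRing.scale /=.
move: ('D_v _ p) ('D_v _ p) (f p 0 i) (g p 0 i) => dgi dfi fi gi.
by case: ifP => _; ring.
Qed.

(** The mean value theorem behind [derive_comm] is real-valued, so the symmetry is proved coordinate
    by coordinate. *)
Lemma d_duv_comm n U (f : R * R -> 'rV[R]_n) p : open U -> U p -> Ck 2 U f ->
  d_du (d_dv f) p = d_dv (d_du f) p.
Proof.
move=> oU Up f2; have [df [dfu fuu fvu] [dfv fuv fvv]] := f2.
have fi2 i := Ck_coord i oU f2.
apply/rowP => i; apply: etrans (derive_coord _ i (dfv p Up)) _.
apply: etrans _ (esym (derive_coord _ i (dfu p Up))).
have [di [diu iuu ivu] [div iuv ivv]] := fi2 i.
have E : 'D_(1, 0) ('D_(0, 1) (fun q => f q 0 i)) p =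
         'D_(0, 1) ('D_(1, 0) (fun q => f q 0 i)) p.
  apply: (@derive_comm _ _ _ U) => //; last 2 first.
  - exact: iuv.
  - exact: ivu.
  move=> q Uq; split; apply: diff_derivable;
    [exact: di | exact: di | exact: div | exact: diu].
rewrite /d_du /d_dv; transitivity ('D_(1, 0) ('D_(0, 1) (fun q => f q 0 i)) p).
  apply: near_eq_derive; apply: open_near_eq oU Up _ => q Uq.
  by apply: derive_coord; exact: df.
rewrite E; apply: near_eq_derive; apply: open_near_eq oU Up _ => q Uq.
by apply: esym; apply: derive_coord; exact: df.
Qed.

End Ck.

(** * Orthogonal projections *)

Section MdotTheory.
Variables (A : comNzRingType) (n : nat).
Implicit Types a b c : 'rV[A]_n.

Lemma mdotC a b : mdot a b = mdot b a.
Proof. by apply: eq_bigr => i _; rewrite mulrC. Qed.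

Lemma mdotDl a b c : mdot (a + b) c = mdot a c + mdot b c.
Proof.
rewrite /mdot -big_split; apply: eq_bigr => i _; rewrite mxE mulrDl.
by case: ifP => // _; rewrite opprD.
Qed.

Lemma mdotZl k a b : mdot (k *: a) b = k * mdot a b.
Proof.
rewrite /mdot mulr_sumr; apply: eq_bigr => i _; rewrite mxE -mulrA.
by case: ifP => // _; rewrite mulrN.
Qed.

Lemma mdotNl a b : mdot (- a) b = - mdot a b.
Proof. by rewrite -scaleN1r mdotZl mulN1r. Qed.

Lemma mdotBl a b c : mdot (a - b) c = mdot a c - mdot b c.
Proof. by rewrite mdotDl mdotNl. Qed.

Lemma mdotDr a b c : mdot c (a + b) = mdot c a + mdot c b.
Proof. by rewrite mdotC mdotDl !(mdotC c). Qed.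

Lemma mdotZr k a b : mdot b (k *: a) = k * mdot b a.
Proof. by rewrite mdotC mdotZl mdotC. Qed.

Lemma mdotNr a b : mdot b (- a) = - mdot b a.
Proof. by rewrite mdotC mdotNl mdotC. Qed.

Lemma mdotBr a b c : mdot c (a - b) = mdot c a - mdot c b.
Proof. by rewrite mdotC mdotBl !(mdotC c). Qed.

Lemma mdot0l a : mdot 0 a = 0.
Proof. by rewrite -(scale0r 0) mdotZl mul0r. Qed.

Lemma mdot0r a : mdot a 0 = 0.
Proof. by rewrite mdotC mdot0l. Qed.

Lemma mdot_nondegenerate a : (forall b, mdot a b = 0) -> a = 0.
Proof.
move=> a0; apply/rowP => i; rewrite mxE.
have := a0 (delta_mx 0 i); rewrite /mdot (bigD1 i) //= big1 => [|j ji].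
  rewrite addr0 mxE !eqxx mulr1; case: ifP => // _ /eqP.
  by rewrite oppr_eq0 => /eqP.
by rewrite mxE eqxx (negPf ji) mulr0 oppr0 if_same.
Qed.

Definition mdotE := (mdotDl, mdotDr, mdotBl, mdotBr, mdotNl, mdotNr, mdotZl, mdotZr).

(** Two candidates in [W] differ by a vector orthogonal to [W]; the last hypothesis is the
    nondegeneracy that makes them equal, so [xget] has a single choice. *)
Lemma orth_proj_eq (W : set 'rV[A]_n) a b : W b ->
  (forall w, W w -> mdot (a - b) w = 0) ->
  (forall c, W c -> (forall w, W w -> mdot (b - c) w = 0) -> b = c) ->
  orth_proj W a = b.
Proof.
move=> Wb ab uniq_b; apply: xget_unique => // c [Wc ac].
apply: esym; apply: uniq_b => // w Ww.
by rewrite -(subrKA a) mdotDl -(opprB a b) mdotNl ab // oppr0 add0r ac.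
Qed.

End MdotTheory.

(** * Double vectors as pairs of real vectors *)

Section DoubleMdot.
Variables (R : comNzRingType) (n : nat).
Implicit Types (s t : 'rV[dnum R]_n) (a b : 'rV[R]_n).

Lemma dRe_sum (I : Type) (r : seq I) (F : I -> dnum R) :
  dRe (\sum_(i <- r) F i) = \sum_(i <- r) dRe (F i).
Proof. by elim: r => [|i r IH]; rewrite ?big_nil // !big_cons -IH. Qed.

Lemma dIm_sum (I : Type) (r : seq I) (F : I -> dnum R) :
  dIm (\sum_(i <- r) F i) = \sum_(i <- r) dIm (F i).
Proof. by elim: r => [|i r IH]; rewrite ?big_nil // !big_cons -IH. Qed.

Lemma dRe_mdot s t : dRe (mdot s t) = mdot (vRe s) (vRe t) + mdot (vIm s) (vIm t).
Proof.
rewrite /mdot dRe_sum -big_split; apply: eq_bigr => i _; rewrite !mxE.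
by case: ifP => //= _; rewrite opprD.
Qed.

Lemma dIm_mdot s t : dIm (mdot s t) = mdot (vRe s) (vIm t) + mdot (vIm s) (vRe t).
Proof.
rewrite /mdot dIm_sum -big_split; apply: eq_bigr => i _; rewrite !mxE.
by case: ifP => //= _; rewrite opprD.
Qed.

Lemma dvec_eq s t : vRe s = vRe t -> vIm s = vIm t -> s = t.
Proof.
move=> rE iE; apply/rowP => i.
have := congr1 (fun w : 'rV[R]_n => w 0 i) rE.
have := congr1 (fun w : 'rV[R]_n => w 0 i) iE; rewrite !mxE.
by case: (s 0 i) => ? ?; case: (t 0 i) => ? ? /= -> ->.
Qed.

Definition dvec a b : 'rV[dnum R]_n := \row_j Double (a 0 j) (b 0 j).

Lemma vRe_dvec a b : vRe (dvec a b) = a.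
Proof. by apply/rowP => i; rewrite !mxE. Qed.

Lemma vIm_dvec a b : vIm (dvec a b) = b.
Proof. by apply/rowP => i; rewrite !mxE. Qed.

Lemma vreal_dj a b : vreal a + dj *: vreal b = dvec a b.
Proof.
apply/rowP => i; rewrite !mxE /dj.
by congr Double; rewrite /= !(mul0r, mul1r, addr0, add0r).
Qed.

Lemma vRe_vconj s : vRe (vconj s) = vRe s.
Proof. by apply/rowP => i; rewrite !mxE. Qed.

Lemma vIm_vconj s : vIm (vconj s) = - vIm s.
Proof. by apply/rowP => i; rewrite !mxE. Qed.

Lemma vReB s t : vRe (s - t) = vRe s - vRe t.
Proof. by apply/rowP => i; rewrite !mxE. Qed.

Lemma vImB s t : vIm (s - t) = vIm s - vIm t.
Proof. by apply/rowP => i; rewrite !mxE. Qed.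

Lemma vnorm2_vRe_vIm s : vnorm2 s = mdot (vRe s) (vRe s) - mdot (vIm s) (vIm s).
Proof. by rewrite /vnorm2 dRe_mdot vRe_vconj vIm_vconj mdotNr. Qed.

Lemma dabs2_Re_Im (z : dnum R) : dabs2 z = dRe z ^+ 2 - dIm z ^+ 2.
Proof. by rewrite /dabs2 /= mulrN !expr2. Qed.

(** A coefficient c splits on a real vector into its real and j-parts, so both parts of a
    combination stay in [N]; conversely s is 1 times its real part plus j times its j-part. *)
Lemma lin_span_vreal (N : set 'rV[R]_n) : N 0 ->
  (forall k a b, N a -> N b -> N (k *: a + b)) ->
  lin_span (@vreal R n @` N) = [set s | N (vRe s) /\ N (vIm s)].
Proof.
move=> N0 Nlin; apply/seteqP; split => s /=.
  move=> [k [c [v [vN ->]]]].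
  have [v' v'P] : {v' : 'I_k -> 'rV[R]_n & forall i, N (v' i) /\ vreal (v' i) = v i}.
    have v'P i : exists w, N w /\ vreal w = v i by have [w Nw <-] := vN i; exists w.
    by exists (fun i => sval (cid (v'P i))) => i; exact: svalP (cid (v'P i)).
  have -> : vRe (\sum_i c i *: v i) = \sum_i dRe (c i) *: v' i.
    apply/rowP => j; rewrite mxE !summxE dRe_sum; apply: eq_bigr => i _.
    by rewrite -(v'P i).2 !mxE /= mulr0 addr0.
  have -> : vIm (\sum_i c i *: v i) = \sum_i dIm (c i) *: v' i.
    apply/rowP => j; rewrite mxE !summxE dIm_sum; apply: eq_bigr => i _.
    by rewrite -(v'P i).2 !mxE /= mulr0 add0r.
  by split; elim/big_rec: _ => // i w _ Nw; apply: Nlin => //; exact: (v'P i).1.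
move=> [Nr Ni]; exists 2%N, (fun i : 'I_2 => if i == 0 then 1 else dj),
  (fun i : 'I_2 => vreal (if i == 0 then vRe s else vIm s)); split.
  by move=> i; case: ifP => _; [exists (vRe s) | exists (vIm s)].
rewrite big_ord_recl big_ord1 /= scale1r.
rewrite vreal_dj.
by apply: dvec_eq; rewrite ?vRe_dvec ?vIm_dvec.
Qed.

End DoubleMdot.

(** * Projections to a Lorentzian plane and to its orthogonal complement *)

Section LorentzPlane.
Variables (R : fieldType) (n : nat) (a b : 'rV[R]_n) (e : R).
Hypotheses (e0 : e != 0) (aa : mdot a a = e) (bb : mdot b b = - e)
  (ab : mdot a b = 0).
Implicit Types w : 'rV[R]_n.

(** The expansion in the orthogonal basis [a], [b]; the minus sign comes from b . b = - e. *)
Definition tan_part w : 'rV[R]_n := (mdot w a / e) *: a - (mdot w b / e) *: b.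
Definition nor_part w : 'rV[R]_n := w - tan_part w.

Let plane : set 'rV[R]_n := [set w | exists k l, w = k *: a + l *: b].
Let normals : set 'rV[R]_n := [set w | mdot w a = 0 /\ mdot w b = 0].

Let ba : mdot b a = 0. Proof. by rewrite mdotC. Qed.

Lemma mdot_nor_part w : mdot (nor_part w) a = 0 /\ mdot (nor_part w) b = 0.
Proof. by rewrite /nor_part /tan_part !mdotE aa bb ab ba; split; field. Qed.

Lemma tan_part_plane k l : tan_part (k *: a + l *: b) = k *: a + l *: b.
Proof.
rewrite /tan_part !mdotE aa bb ab ba; rewrite -scaleNr; congr (_ *: _ + _ *: _); field.
all: exact: e0.
Qed.

(** Uniqueness: a vector of the plane is determined by its products with [a] and [b], and for every
    projection of [w] these are the products of [w] itself. *)
Lemma orth_proj_plane w : orth_proj plane w = tan_part w.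
Proof.
apply: orth_proj_eq.
- by exists (mdot w a / e), (- (mdot w b / e)); rewrite scaleNr.
- move=> _ [k [l ->]]; have [na nb] := mdot_nor_part w.
  by rewrite mdotDr !mdotZr na nb !mulr0 addr0.
- move=> c [k [l ->]] H.
  have aP : plane a by exists 1, 0; rewrite scale1r scale0r addr0.
  have bP : plane b by exists 0, 1; rewrite scale1r scale0r add0r.
  have := H _ aP; have := H _ bP; rewrite !mdotBl => /subr0_eq Hb /subr0_eq Ha.
  have [na nb] := mdot_nor_part w.
  move: Ha Hb na nb; rewrite /nor_part !mdotBl => Ha Hb /subr0_eq na /subr0_eq nb.
  by rewrite -[RHS]tan_part_plane {2}/tan_part -Ha -Hb -na -nb.
Qed.

(** Any vector is a normal part plus a tangent part, and [w] is orthogonal to both; nondegeneracy of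
    the whole space concludes. *)
Lemma normals_nondegenerate w : normals w ->
  (forall w', normals w' -> mdot w w' = 0) -> w = 0.
Proof.
move=> [wa wb] H; apply: mdot_nondegenerate => w'.
rewrite -[w'](subrK (tan_part w')) mdotDr H ?add0r; last exact: mdot_nor_part.
by rewrite /tan_part !mdotE wa wb !mulr0 subrr.
Qed.

Let normals_lin k w w' : normals w -> normals w' -> normals (k *: w + w').
Proof.
by move=> [wa wb] [wa' wb']; split; rewrite !mdotE ?wa ?wb ?wa' ?wb' mulr0 addr0.
Qed.

Let normals0 : normals 0. Proof. by split; rewrite mdot0l. Qed.

Let normalsB w w' : normals w -> normals w' -> normals (w - w').
Proof. by move=> nw nw'; rewrite addrC -scaleN1r; exact: normals_lin. Qed.

Lemma orth_proj_normals w : orth_proj normals w = nor_part w.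
Proof.
apply: orth_proj_eq; first exact: mdot_nor_part.
- move=> w' [wa wb]; rewrite /nor_part subKr mdotC /tan_part.
  by rewrite !mdotE wa wb !mulr0 subrr.
- move=> c Nc H; apply: subr0_eq; apply: normals_nondegenerate H.
  by apply: normalsB => //; exact: mdot_nor_part.
Qed.

Lemma orth_proj_dnormals (s : 'rV[dnum R]_n) :
  orth_proj (lin_span (@vreal R n @` normals)) s =
  dvec (nor_part (vRe s)) (nor_part (vIm s)).
Proof.
rewrite lin_span_vreal //.
have tanN w w' : normals w' -> mdot (w - nor_part w) w' = 0.
  move=> [wa wb]; rewrite /nor_part subKr mdotC /tan_part.
  by rewrite !mdotE wa wb !mulr0 subrr.
move: (tanN (vRe s)) (tanN (vIm s)) (mdot_nor_part (vRe s)) (mdot_nor_part (vIm s)).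
move: (nor_part (vRe s)) (nor_part (vIm s)) => r i rN iN Nr Ni {tanN}.
have dReE t : dRe (mdot (s - dvec r i) t) =
    mdot (vRe s - r) (vRe t) + mdot (vIm s - i) (vIm t).
  by rewrite dRe_mdot vReB vImB vRe_dvec vIm_dvec.
have dImE t : dIm (mdot (s - dvec r i) t) =
    mdot (vRe s - r) (vIm t) + mdot (vIm s - i) (vRe t).
  by rewrite dIm_mdot vReB vImB vRe_dvec vIm_dvec.
apply: orth_proj_eq.
- by split; rewrite ?vRe_dvec ?vIm_dvec.
- move=> t [tr ti]; have := dReE t; have := dImE t.
  rewrite (rN _ tr) (rN _ ti) (iN _ tr) (iN _ ti) addr0.
  by case: (mdot _ _) => ? ? /= -> ->.
- move=> c [cr ci] H.
  (* Testing against the real vector [dvec w 0] separates the two parts: they are the real and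
     j-parts of a single product. *)
  have H' w : normals w -> mdot (r - vRe c) w = 0 /\ mdot (i - vIm c) w = 0.
    move=> Nw; have E : mdot (dvec r i - c) (dvec w 0) = 0.
      by apply: H; split; rewrite ?vRe_dvec ?vIm_dvec.
    have <- : dRe (mdot (dvec r i - c) (dvec w 0)) = mdot (r - vRe c) w.
      by rewrite dRe_mdot vReB vImB !vRe_dvec !vIm_dvec mdot0r addr0.
    have <- : dIm (mdot (dvec r i - c) (dvec w 0)) = mdot (i - vIm c) w.
      by rewrite dIm_mdot vReB vImB !vRe_dvec !vIm_dvec mdot0r add0r.
    by rewrite E.
  apply: dvec_eq; rewrite ?vRe_dvec ?vIm_dvec; apply: subr0_eq;
    apply: normals_nondegenerate => [|w /H' []//]; exact: normalsB.
Qed.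

Lemma mdot_tan_part w k l :
  mdot (tan_part w) (k *: a + l *: b) = mdot w (k *: a + l *: b).
Proof.
have [na nb] := mdot_nor_part w.
have n0 : mdot (nor_part w) (k *: a + l *: b) = 0.
  by rewrite mdotDr !mdotZr na nb !mulr0 addr0.
by apply/eqP; rewrite -subr_eq0 -mdotBl -opprB mdotNl n0 oppr0.
Qed.

Lemma nor_part_linear k w w' :
  nor_part (k *: w + w') = k *: nor_part w + nor_part w'.
Proof.
rewrite /nor_part /tan_part !mdotE; apply/rowP => i; rewrite !mxE; ring.
Qed.

Lemma nor_part_plane k l : nor_part (k *: a + l *: b) = 0.
Proof. by rewrite /nor_part tan_part_plane subrr. Qed.

Lemma mdot_nor_part_normal w w' : normals w ->
  mdot w (nor_part w') = mdot w w'.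
Proof.
by move=> [wa wb]; rewrite /nor_part /tan_part !mdotE wa wb !mulr0 !subr0.
Qed.

(** Pythagoras: the subtracted term is the square of the tangent part. *)
Lemma mdot_nor_partE w : mdot (nor_part w) (nor_part w) =
  mdot w w - (mdot w a ^+ 2 - mdot w b ^+ 2) / e.
Proof.
rewrite /nor_part /tan_part !mdotE aa bb ab ba (mdotC a w) (mdotC b w); field.
exact: e0.
Qed.

End LorentzPlane.

(** * Surfaces in isothermal coordinates *)

(* With s = (A + C) / 2 + j B and t = a + j b, the relations are t . s = 0: the
   tangent part of s is proportional to t, whence ||t /\ s||^2 = ||t||^2 ||s^N||^2. *)
Lemma normal_part_formulas (R : realType) (n : nat) (a b A B C : 'rV[R]_n) (e : R) :
  e != 0 -> mdot a a = e -> mdot b b = - e -> mdot a b = 0 ->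
  mdot A a + mdot B b = 0 -> mdot A b + mdot B a = 0 ->
  mdot B a + mdot C b = 0 -> mdot B b + mdot C a = 0 ->
  nor_part a b e C = nor_part a b e A ->
  let l := nor_part a b e A in let m := nor_part a b e B in
  let s := dvec (2^-1 *: (A + C)) B in let t := dvec a b in
  (mdot m m - mdot l l) / e ^+ 2 =
    - (4 * vnorm2 (dvec (nor_part a b e (2^-1 *: (A + C))) m) / vnorm2 t ^+ 2) /\
  (mdot m m - mdot l l) / e ^+ 2 = - (4 * wedge_norm2 t s / vnorm2 t ^+ 3).
Proof.
move=> e0 aa bb ab r1 r2 r3 r4 nC l m s t.
have ba : mdot b a = 0 by rewrite mdotC.
have nh : nor_part a b e (2^-1 *: (A + C)) = l.
  (* Written as A plus half of C - A, whose normal part vanishes by [nC]. *)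
  have -> : 2^-1 *: (A + C) = 2^-1 *: ((- 1) *: A + C) + A.
    by apply/rowP => i; rewrite !mxE; field.
  by rewrite !nor_part_linear nC scaleN1r addNr scaler0 add0r.
have tE : vnorm2 t = 2 * e.
  by rewrite vnorm2_vRe_vIm vRe_dvec vIm_dvec aa bb; ring.
(* [ha] and [hb] are the real and j-parts of t . s = 0, each the average of two of the
   hypotheses. *)
have ha : mdot (2^-1 *: (A + C)) a = - mdot B b.
  rewrite !mdotE; apply/eqP; rewrite -subr_eq0; apply/eqP.
  transitivity (2^-1 * ((mdot A a + mdot B b) + (mdot B b + mdot C a))); first by field.
  by rewrite r1 r4 addr0 mulr0.
have hb : mdot (2^-1 *: (A + C)) b = - mdot B a.
  rewrite !mdotE; apply/eqP; rewrite -subr_eq0; apply/eqP.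
  transitivity (2^-1 * ((mdot A b + mdot B a) + (mdot B a + mdot C b))); first by field.
  by rewrite r2 r3 addr0 mulr0.
rewrite nh tE; split.
  rewrite vnorm2_vRe_vIm vRe_dvec vIm_dvec.
  by move: (mdot m m) (mdot l l) => ? ?; field.
(* By [ha] and [hb] the product of conj t with s is -2 B . b + 2 j B . a, and the wedge norm becomes
   2 e (l . l - m . m); dividing by (2 e)^3 leaves the factor e^-2. *)
rewrite /wedge_norm2 tE vnorm2_vRe_vIm dabs2_Re_Im dRe_mdot dIm_mdot.
rewrite vRe_vconj vIm_vconj !vRe_dvec !vIm_dvec.
have := mdot_nor_partE e0 aa bb ab B; rewrite -/m => ->.
have := mdot_nor_partE e0 aa bb ab (2^-1 *: (A + C)); rewrite nh ha hb => ->.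
move: ha hb; move: (2^-1 *: (A + C)) => h ha hb.
rewrite !mdotNl (mdotC a h) (mdotC b h) ha hb (mdotC a B) (mdotC b B).
by move: (mdot B B) (mdot h h) (mdot B a) (mdot B b) => ? ? ? ?; field.
Qed.

Section IsothermalSurface.
(* The partial derivatives are kept as variables: unifying two unfolded partial
   derivatives is intractable. *)
Variables (R : realType) (n : nat) (x xu xv xuu xuv xvv : R * R -> 'rV[R]_n)
  (E : R * R -> R) (U : set (R * R)).
Hypotheses (xuE : xu = d_du x) (xvE : xv = d_dv x) (EE : E = metricE x)
  (xuuE : xuu = d_du xu) (xuvE : xuv = d_dv xu) (xvvE : xvv = d_dv xv).
Hypotheses (oU : open U) (x_smooth : smooth U x) (x_iso : isothermal x U)
  (E_lt0 : forall p, U p -> E p < 0).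

Local Notation tanp q := (tan_part (xu q) (xv q) (E q)).
Local Notation norp q := (nor_part (xu q) (xv q) (E q)).

Lemma smooth_du : smooth U xu.
Proof. by move=> k; rewrite xuE; have [_ + _] := x_smooth k.+1; exact. Qed.
Lemma smooth_dv : smooth U xv.
Proof. by move=> k; rewrite xvE; have [_ _] := x_smooth k.+1; exact. Qed.
Lemma mdot_xu q : mdot (xu q) (xu q) = E q.
Proof. by rewrite EE xuE. Qed.
Lemma mdot_xv q : U q -> mdot (xv q) (xv q) = - E q.
Proof. by rewrite EE xvE => /x_iso [-> _]; rewrite opprK. Qed.
Lemma mdot_xu_xv q : U q -> mdot (xu q) (xv q) = 0.
Proof. by rewrite xuE xvE => /x_iso []. Qed.
Lemma metricE_neq0 q : U q -> E q != 0.
Proof. by move=> Uq; rewrite lt_eqF // E_lt0. Qed.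

Lemma smooth_metricE : smooth U E.
Proof.
move=> k; have := Ck_mdot oU (smooth_du k) (smooth_du k).
by apply: Ck_eq => // q _; exact: mdot_xu.
Qed.

Lemma diff_x q w : U q -> 'd x q w = w.1 *: xu q + w.2 *: xv q.
Proof.
move=> Uq; have dx := Ck_differentiable (x_smooth 1) Uq.
by rewrite -deriveE // derive_prod // xuE xvE.
Qed.

Lemma tangent_spaceE q : U q ->
  tangent_space x q = [set w | exists k l, w = k *: xu q + l *: xv q].
Proof.
move=> Uq; apply/seteqP; split=> [_ [w _ <-]|_ [k [l ->]]] /=.
  by rewrite diff_x //; exists w.1, w.2.
by exists (k, l) => //; rewrite diff_x.
Qed.

Lemma normal_spaceE q : U q ->
  Defs.normal_space x q = [set w | mdot w (xu q) = 0 /\ mdot w (xv q) = 0].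
Proof.
move=> Uq; apply/seteqP; rewrite /Defs.normal_space tangent_spaceE //; split=> w /= H.
  split; apply: H; first by exists 1, 0; rewrite scale1r scale0r addr0.
  by exists 0, 1; rewrite scale1r scale0r add0r.
by move=> _ [k [l ->]]; rewrite mdotDr !mdotZr H.1 H.2 !mulr0 addr0.
Qed.

Lemma tangent_projE q w : U q -> orth_proj (tangent_space x q) w = tanp q w.
Proof.
move=> Uq; rewrite tangent_spaceE //.
apply: orth_proj_plane;
  [exact: metricE_neq0|exact: mdot_xu|exact: mdot_xv|exact: mdot_xu_xv].
Qed.

Lemma normal_projE q w : U q -> orth_proj (Defs.normal_space x q) w = norp q w.
Proof.
move=> Uq; rewrite normal_spaceE //.
apply: orth_proj_normals;
  [exact: metricE_neq0|exact: mdot_xu|exact: mdot_xv|exact: mdot_xu_xv].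
Qed.

Lemma dnormal_projE q s : U q ->
  dnormal_proj x q s = dvec (norp q (vRe s)) (norp q (vIm s)).
Proof.
move=> Uq; rewrite /dnormal_proj normal_spaceE //.
apply: orth_proj_dnormals;
  [exact: metricE_neq0|exact: mdot_xu|exact: mdot_xv|exact: mdot_xu_xv].
Qed.

Lemma pushE X q : U q -> push x X q = (X q).1 *: xu q + (X q).2 *: xv q.
Proof. by move=> Uq; rewrite /push diff_x. Qed.

Lemma smooth_push U' X : open U' -> U' `<=` U -> smooth U' X ->
  smooth U' (push x X).
Proof.
move=> oU' sU Xs k.
apply: (Ck_eq (f := fun q => (X q).1 *: xu q + (X q).2 *: xv q)) => //.
  by move=> q /sU Uq; rewrite pushE.
apply: CkD => //; apply: CkZ => //.
- exact: Ck_fst (Xs k).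
- exact: CkS sU (smooth_du k).
- exact: Ck_snd (Xs k).
- exact: CkS sU (smooth_dv k).
Qed.

Lemma d_du_xv q : U q -> d_du xv q = xuv q.
Proof. by move=> Uq; rewrite xuvE xuE xvE (d_duv_comm oU Uq (x_smooth 2)). Qed.

Lemma derive_xu q w : U q -> 'D_w xu q = w.1 *: xuu q + w.2 *: xuv q.
Proof.
move=> Uq; rewrite xuuE xuvE; apply: derive_prod.
exact: Ck_differentiable (smooth_du 1) Uq.
Qed.

Lemma derive_xv q w : U q -> 'D_w xv q = w.1 *: xuv q + w.2 *: xvv q.
Proof.
move=> Uq; rewrite -d_du_xv // xvvE; apply: derive_prod.
exact: Ck_differentiable (smooth_dv 1) Uq.
Qed.

(** * Vector fields on a smaller open set: flatness, Gauss equation, second fundamental form *)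

Section Fields.
Variable U' : set (R * R).
Hypotheses (oU' : open U') (sU : U' `<=` U).
Implicit Types (X Y Z W : R * R -> R * R) (V : R * R -> 'rV[R]_n).

Lemma nablaE X V q : smooth U' V -> U' q ->
  nabla X V q = (X q).1 *: d_du V q + (X q).2 *: d_dv V q.
Proof.
by move=> Vs Uq; rewrite /nabla derive_prod //; exact: Ck_differentiable (Vs 1) Uq.
Qed.

Lemma smooth_nabla X V : smooth U' X -> smooth U' V -> smooth U' (nabla X V).
Proof.
move=> Xs Vs k; have [_ Vu Vv] := Vs k.+1.
apply: (Ck_eq (f := fun q => (X q).1 *: d_du V q + (X q).2 *: d_dv V q)) => //.
  by move=> q Uq; rewrite nablaE.
exact: CkD oU' (CkZ oU' (Ck_fst oU' (Xs k)) Vu) (CkZ oU' (Ck_snd oU' (Xs k)) Vv).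
Qed.

(** The projection is chosen point by point, but on [U'] it agrees with [tan_part], a rational
    formula whose only denominator [E] does not vanish. *)
Lemma smooth_nablaT X V : smooth U' X -> smooth U' V -> smooth U' (nablaT x X V).
Proof.
move=> Xs Vs k; have DV := smooth_nabla Xs Vs k.
have Eu := CkS sU (smooth_du k); have Ev := CkS sU (smooth_dv k).
have Ei : Ck k U' (fun q => (E q)^-1).
  apply: CkV => // [q /sU|]; first exact: metricE_neq0.
  exact: CkS sU (smooth_metricE k).
apply: (Ck_eq (f := fun q => tanp q (nabla X V q))) => //.
  by move=> q /sU Uq; rewrite /nablaT tangent_projE.
apply: CkD => //; last apply: CkN => //; apply: CkZ => //; apply: CkM => //;
  exact: Ck_mdot.
Qed.

(** Second derivatives of [V] cancel by symmetry of mixed partials; the derivatives of the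
    components of [X] and [Y] cancel against the bracket. *)
Lemma nabla_flat X Y V p : smooth U' X -> smooth U' Y -> smooth U' V -> U' p ->
  nabla X (nabla Y V) p - nabla Y (nabla X V) p - nabla (lie_bracket X Y) V p = 0.
Proof.
move=> Xs Ys Vs Up.
have [Vu VuE] : {Vu | Vu = d_du V} := exist _ _ erefl.
have [Vv VvE] : {Vv | Vv = d_dv V} := exist _ _ erefl.
have [dVu dVv] : differentiable Vu p /\ differentiable Vv p.
  by rewrite VuE VvE; have [_ [/(_ p Up) dVu _ _] [/(_ p Up) dVv _ _]] := Vs 2.
have dX := Ck_differentiable (Xs 1) Up; have dY := Ck_differentiable (Ys 1) Up.
have DV X' q : U' q -> nabla X' V q = (X' q).1 *: Vu q + (X' q).2 *: Vv q.
  by move=> Uq; rewrite VuE VvE; exact: nablaE.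
have comm : d_du Vv p = d_dv Vu p by rewrite VuE VvE (d_duv_comm oU' Up (Vs 2)).
have second X' Y' : smooth U' Y' -> nabla X' (nabla Y' V) p =
    (Y' p).1 *: 'D_(X' p) Vu p + ('D_(X' p) Y' p).1 *: Vu p +
    ((Y' p).2 *: 'D_(X' p) Vv p + ('D_(X' p) Y' p).2 *: Vv p).
  move=> Y's; have dY' := Ck_differentiable (Y's 1) Up.
  have d1 := Ck_differentiable (Ck_fst oU' (Y's 1)) Up.
  have d2 := Ck_differentiable (Ck_snd oU' (Y's 1)) Up.
  rewrite derive_fst // derive_snd //.
  have [dz1 e1] := derive_scale (X' p) d1 dVu.
  have [dz2 e2] := derive_scale (X' p) d2 dVv.
  have dD := deriveD (diff_derivable (v := X' p) dz1) (diff_derivable (v := X' p) dz2).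
  apply: etrans (etrans dD (congr2 +%R e1 e2)).
  apply: near_eq_derive; apply: open_near_eq oU' Up _ => q Uq.
  exact: DV.
rewrite !second // DV // /lie_bracket /=.
rewrite !(derive_prod _ dVu) !(derive_prod _ dVv) comm.
move: (d_du Vu p) (d_dv Vu p) (d_dv Vv p) => A B C.
move: (Vu p) (Vv p) ('D_(X p) Y p) ('D_(Y p) X p) => a b c d.
by apply/rowP => i; rewrite !mxE; ring.
Qed.

(* Differentiate nablaT_Y Z . W = nabla_Y Z . W along X; the normal part of
   nabla_Y Z only sees the normal part of nabla_X W. *)
Lemma mdot_nablaT2 X Y Z W p : smooth U' X -> smooth U' Y -> smooth U' Z ->
  smooth U' W -> U' p ->
  mdot (nablaT x X (nablaT x Y (push x Z)) p) (push x W p) =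
  mdot (nabla X (nabla Y (push x Z)) p) (push x W p) +
  mdot (second_form x Y Z p) (second_form x X W p).
Proof.
move=> Xs Ys Zs Ws Up; have Uxp := sU Up.
have Vs := smooth_push oU' sU Zs; have pWs := smooth_push oU' sU Ws.
have dV := Ck_differentiable (smooth_nabla Ys Vs 1) Up.
have dT := Ck_differentiable (smooth_nablaT Ys Vs 1) Up.
have dW := Ck_differentiable (pWs 1) Up.
have e0 := metricE_neq0 Uxp; have uu := mdot_xu p.
have vv := mdot_xv Uxp; have uv := mdot_xu_xv Uxp.
have tanE w : mdot (orth_proj (tangent_space x p) w) (push x W p) =
    mdot w (push x W p).
  by rewrite tangent_projE // pushE // mdot_tan_part.
have key : 'D_(X p) (fun q => mdot (nablaT x Y (push x Z) q) (push x W q)) p =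
           'D_(X p) (fun q => mdot (nabla Y (push x Z) q) (push x W q)) p.
  apply: near_eq_derive; apply: open_near_eq oU' Up _ => q /sU Uq.
  rewrite /nablaT tangent_projE // pushE // mdot_tan_part //.
  - exact: metricE_neq0.
  - exact: mdot_xu.
  - exact: mdot_xv.
  - exact: mdot_xu_xv.
move: key; rewrite !derive_mdot // => key.
rewrite [nablaT x X _ p]/nablaT tanE /nabla.
(* Adding this term completes the product rule on the left. The difference of the two terms
   containing the derivative of [push x W] is then the normal part of nabla_Y Z against that
   derivative. *)
apply: (addIr (mdot (nablaT x Y (push x Z) p) ('D_(X p) (push x W) p))).
apply: etrans key _; rewrite -addrA; congr (_ + _); apply/eqP.
rewrite -subr_eq -mdotBl; apply/eqP.
rewrite /second_form !normal_projE // mdot_nor_part_normal //; last first.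
  exact: mdot_nor_part.
by rewrite /nablaT tangent_projE.
Qed.

Lemma gauss_equation X Y Z W p : smooth U' X -> smooth U' Y -> smooth U' Z ->
  smooth U' W -> U' p ->
  mdot (curvature x X Y Z p) (push x W p) =
  mdot (second_form x Y Z p) (second_form x X W p) -
  mdot (second_form x X Z p) (second_form x Y W p).
Proof.
move=> Xs Ys Zs Ws Up; have Uxp := sU Up.
have mdotB3 (a b c w : 'rV[R]_n) :
    mdot (a - b - c) w = mdot a w - mdot b w - mdot c w.
  by rewrite 2!mdotBl.
have bracketE : mdot (nablaT x (lie_bracket X Y) (push x Z) p) (push x W p) =
    mdot (nabla (lie_bracket X Y) (push x Z) p) (push x W p).
  rewrite /nablaT tangent_projE // (pushE W Uxp) mdot_tan_part //.
  - exact: metricE_neq0.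
  - exact: mdot_xu.
  - exact: mdot_xv.
  - exact: mdot_xu_xv.
have flat0 := congr1 (fun a => mdot a (push x W p))
  (nabla_flat Xs Ys (smooth_push oU' sU Zs) Up).
have {}flat0 := etrans (esym (mdotB3 _ _ _ _)) (etrans flat0 (mdot0l _)).
(* The cancellation is stated for arbitrary reals, so [ring] never meets the derivative terms. *)
have cancel_flat (k a b c a' b' c' s t : R) : k = a - b - c -> a = a' + s ->
    b = b' + t -> c = c' -> a' - b' - c' = 0 -> k = s - t.
  by move=> -> -> -> -> flat; rewrite -[RHS]add0r -flat; ring.
exact: cancel_flat (mdotB3 _ _ _ _) (mdot_nablaT2 Xs Ys Zs Ws Up)
  (mdot_nablaT2 Ys Xs Zs Ws Up) bracketE flat0.
Qed.

(** Derivatives of the components of [Z] multiply x_u and x_v and so vanish in the normal part: only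
    the values of the fields at p remain. *)
Lemma second_formE Y Z p : smooth U' Y -> smooth U' Z -> U' p ->
  second_form x Y Z p =
  ((Y p).1 * (Z p).1) *: norp p (xuu p) +
  ((Y p).1 * (Z p).2 + (Y p).2 * (Z p).1) *: norp p (xuv p) +
  ((Y p).2 * (Z p).2) *: norp p (xvv p).
Proof.
move=> Ys Zs Up; have Uxp := sU Up.
have d1 := Ck_differentiable (Ck_fst oU' (Zs 1)) Up.
have d2 := Ck_differentiable (Ck_snd oU' (Zs 1)) Up.
have dxu := Ck_differentiable (smooth_du 1) Uxp.
have dxv := Ck_differentiable (smooth_dv 1) Uxp.
rewrite /second_form normal_projE //.
have -> : nabla Y (push x Z) p =
    (Z p).1 *: 'D_(Y p) xu p + 'D_(Y p) (fun q => (Z q).1) p *: xu p +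
    ((Z p).2 *: 'D_(Y p) xv p + 'D_(Y p) (fun q => (Z q).2) p *: xv p).
  have [dz1 e1] := derive_scale (Y p) d1 dxu.
  have [dz2 e2] := derive_scale (Y p) d2 dxv.
  have dD := deriveD (diff_derivable (v := Y p) dz1) (diff_derivable (v := Y p) dz2).
  apply: etrans (etrans dD (congr2 +%R e1 e2)).
  apply: near_eq_derive; apply: open_near_eq oU' Up _ => q /sU Uq.
  exact: pushE.
rewrite derive_xu // derive_xv //.
have planeE k l : norp p (k *: xu p + l *: xv p) = 0.
  apply: nor_part_plane;
  [exact: metricE_neq0|exact: mdot_xu|exact: mdot_xv|exact: mdot_xu_xv].
have linE := nor_part_linear (xu p) (xv p) (E p).
move: (xuu p) (xuv p) (xvv p) => A B C; move: ('D_(Y p) _ p) ('D_(Y p) _ p) => l k.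
case: (Y p) (Z p) => y1 y2 [z1 z2] /=.
have -> : z1 *: (y1 *: A + y2 *: B) + k *: xu p +
     (z2 *: (y1 *: B + y2 *: C) + l *: xv p)
   = (y1 * z1) *: A + ((y1 * z2 + y2 * z1) *: B + ((y2 * z2) *: C +
       (k *: xu p + l *: xv p))).
  by apply/rowP => i; rewrite !mxE; ring.
by rewrite 3!linE planeE addr0 !addrA.
Qed.

End Fields.

(** * Orthonormal frames and the curvatures computed in them *)

Lemma mdot_push X Y q : U q -> mdot (push x X q) (push x Y q) =
  E q * ((X q).1 * (Y q).1 - (X q).2 * (Y q).2).
Proof.
move=> Uq; rewrite !pushE //.
move: (mdot_xu q) (mdot_xv Uq) (mdot_xu_xv Uq).
move: (xu q) (xv q) => a b aa bb ab; have ba : mdot b a = 0 by rewrite mdotC.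
by rewrite !mdotE aa bb ab ba; ring.
Qed.

(* On the hyperbola E (a^2 - b^2) = -1, the choice a + b = 1 gives a frame that is
   rational in E. *)
Lemma exists_local_frame p : U p -> exists X1 X2, local_frame x p X1 X2.
Proof.
(* The solution of a + b = 1, a - b = - 1 / E is a = [f (- 1)], b = [f 1]. *)
move=> Up; pose f s q := 2^-1 * (1 + s * (E q)^-1).
have fs s : smooth U (f s).
  move=> k; have Ek : Ck k U (fun q => (E q)^-1).
    apply: CkV => //; first exact: metricE_neq0.
    exact: smooth_metricE.
  apply: CkM => //; first exact: Ck_cst.
  apply: CkD => //; first exact: Ck_cst.
  by apply: CkM => //; exact: Ck_cst.
exists (fun q => (f (- 1) q, f 1 q)), (fun q => (f 1 q, f (- 1) q)).
exists U; split => //; split.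
- by move=> k; exact: Ck_pair oU (fs (- 1) k) (fs 1 k).
- by move=> k; exact: Ck_pair oU (fs 1 k) (fs (- 1) k).
- move=> q Uq; rewrite !mdot_push //= /f; have := metricE_neq0 Uq.
  by move: (E q) => e e0; split; field.
Qed.

Lemma orthonormal_pair (e a b c d : R) : e * (a * a - b * b) = - 1 ->
  e * (c * c - d * d) = 1 -> e * (a * c - b * d) = 0 ->
  exists k, [/\ k ^+ 2 = 1, c = k * b & d = k * a].
Proof.
move=> h1 h2 h3.
have e0 : e != 0.
  by apply/eqP => e0; move/eqP: h1; rewrite e0 mul0r eq_sym oppr_eq0 oner_eq0.
have bd : b * d = a * c.
  by apply/eqP; rewrite eq_sym -subr_eq0; move/eqP: h3; rewrite mulf_eq0 (negPf e0).
(* The value of k is forced: c = k b and d = k a give b c - a d = k (b^2 - a^2) = k / e. *)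
have cE : c = e * (b * c - a * d) * b.
  have -> : e * (b * c - a * d) * b = e * (b * b) * c - e * a * (b * d) by ring.
  by rewrite bd -[LHS]mul1r -[1]opprK -h1; ring.
have dE : d = e * (b * c - a * d) * a.
  have -> : e * (b * c - a * d) * a = e * b * (a * c) - e * (a * a) * d by ring.
  by rewrite -bd -[LHS]mul1r -[1]opprK -h1; ring.
exists (e * (b * c - a * d)); split=> //.
move: cE dE; set k := e * _ => cE dE; rewrite -h2 cE dE.
have -> : e * (k * b * (k * b) - k * a * (k * a)) = - (e * (a * a - b * b)) * k ^+ 2.
  by ring.
by rewrite h1 opprK mul1r.
Qed.

(** The open set of a local frame may leave [U], so the frame is restricted to the intersection. *)
Lemma local_frameE p X1 X2 : U p -> local_frame x p X1 X2 ->
  exists U' k, [/\ open U', U' `<=` U, U' p, smooth U' X1 & smooth U' X2] /\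
  [/\ E p * ((X1 p).1 ^+ 2 - (X1 p).2 ^+ 2) = - 1, k ^+ 2 = 1,
      (X2 p).1 = k * (X1 p).2 & (X2 p).2 = k * (X1 p).1].
Proof.
move=> Up [U1 [oU1 U1p [X1s X2s fr]]].
have [] := fr p U1p; rewrite !mdot_push // => h1 h2 h3.
have [k [k2 e1 e2]] := orthonormal_pair h1 h2 h3.
exists (U1 `&` U), k; split.
  split; [exact: openI | by move=> q [] | by [] | |].
  - by move=> j; apply: CkS (X1s j) => q [].
  - by move=> j; apply: CkS (X2s j) => q [].
by split=> //; rewrite !expr2.
Qed.

Local Notation L p := (norp p (xuu p)).
Local Notation M p := (norp p (xuv p)).

Lemma minimal_norp p : U p -> mean_curvature x p = 0 ->
  norp p (xvv p) = L p.
Proof.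
move=> Up; rewrite /mean_curvature => H0.
(* Since a frame exists, the vanishing mean curvature is that of an actual frame and not the default
   value of [xget]. *)
have /(xgetPex 0) : exists h, exists X1 X2, local_frame x p X1 X2 /\
    h = 2^-1 *: (- second_form x X1 X1 p + second_form x X2 X2 p).
  have [X1 [X2 fr]] := exists_local_frame Up; eexists; exists X1, X2.
  by split; [exact: fr | reflexivity].
rewrite H0 => -[X1 [X2 [/(local_frameE Up) [U' [k [[oU' sU U'p X1s X2s]]]]]]].
move: (second_formE oU' sU X1s X1s U'p) (second_formE oU' sU X2s X2s U'p) => -> ->.
have [l ->] : {l | L p = l} := exist _ _ erefl.
have [m ->] : {m | M p = m} := exist _ _ erefl.
have [v ->] : {v | norp p (xvv p) = v} := exist _ _ erefl.
move: (X1 p) (X2 p) => [a b] [c d] /= [h1 k2 -> ->] /esym/eqP.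
rewrite scaler_eq0 invr_eq0 pnatr_eq0 /= => /eqP H; apply: esym.
(* With X2 = k (b, a) and k^2 = 1 the mixed terms in [m] cancel; the scalar left over is nonzero
   because E (a^2 - b^2) = -1. *)
have {}H : (a ^+ 2 - b ^+ 2) *: (l - v) = 0.
  rewrite -[RHS]oppr0 -H; apply/rowP => i; rewrite !mxE.
  have -> : k * b * (k * b) = k ^+ 2 * b ^+ 2 by ring.
  have -> : k * a * (k * a) = k ^+ 2 * a ^+ 2 by ring.
  have -> : k * b * (k * a) + k * a * (k * b) = k ^+ 2 * (a * b + b * a) by ring.
  by rewrite k2; ring.
move/eqP: H; rewrite scaler_eq0 => /orP[/eqP h0|]; last by rewrite subr_eq0 => /eqP.
by move/eqP: h1; rewrite h0 mulr0 eq_sym oppr_eq0 oner_eq0.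
Qed.

Lemma minimal_gauss_curvature p : U p -> norp p (xvv p) = L p ->
  gauss_curvature x p = (mdot (M p) (M p) - mdot (L p) (L p)) / E p ^+ 2.
Proof.
move=> Up vvE; rewrite /gauss_curvature.
have /(xgetPex 0) : exists k, exists X1 X2, local_frame x p X1 X2 /\
    k = - mdot (curvature x X1 X2 X2 p) (push x X1 p).
  have [X1 [X2 fr]] := exists_local_frame Up; eexists; exists X1, X2.
  by split; [exact: fr | reflexivity].
move=> [X1 [X2 [/(local_frameE Up) [U' [k [[oU' sU U'p X1s X2s]]]]]]] + ->.
rewrite (gauss_equation oU' sU X1s X2s X2s X1s U'p).
move: (second_formE oU' sU X2s X2s U'p) (second_formE oU' sU X1s X1s U'p) => -> ->.
move: (second_formE oU' sU X1s X2s U'p) (second_formE oU' sU X2s X1s U'p) => -> ->.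
rewrite vvE; have [l ->] : {l | L p = l} := exist _ _ erefl.
have [m ->] : {m | M p = m} := exist _ _ erefl.
have := metricE_neq0 Up.
move: (X1 p) (X2 p) (E p) => [a b] [c d] e /= e0 [h1 k2 -> ->].
(* The frame enters K through (a^2 + b^2)^2 - 4 a^2 b^2 = (a^2 - b^2)^2 times k^2. Inserting (e (a^2
   - b^2))^2 = 1 and k^2 = 1 on the right reduces the claim to a polynomial identity, whatever frame
   was selected. *)
have -> : (mdot m m - mdot l l) / e ^+ 2 =
    (mdot m m - mdot l l) * (e * (a ^+ 2 - b ^+ 2)) ^+ 2 / e ^+ 2.
  by rewrite h1 sqrrN expr1n mulr1.
have -> : (mdot m m - mdot l l) * (e * (a ^+ 2 - b ^+ 2)) ^+ 2 / e ^+ 2 =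
    (mdot m m - mdot l l) * (a ^+ 2 - b ^+ 2) ^+ 2 * (k ^+ 2).
  by rewrite k2; field.
by rewrite !mdotE (mdotC m l); ring.
Qed.

(** These are the derivatives of x_u . x_u + x_v . x_v = 0 and x_u . x_v = 0; the two coordinate
    directions yield the four relations of [normal_part_formulas]. *)
Lemma derive_metric p w : U p ->
  mdot ('D_w xu p) (xu p) + mdot ('D_w xv p) (xv p) = 0 /\
  mdot ('D_w xu p) (xv p) + mdot ('D_w xv p) (xu p) = 0.
Proof.
move=> Up; have du := Ck_differentiable (smooth_du 1) Up.
have dv := Ck_differentiable (smooth_dv 1) Up.
have uu := derive_mdot w du du; have vv := derive_mdot w dv dv.
have uv := derive_mdot w du dv.
have dvv : derivable (fun q => mdot (xv q) (xv q)) p w.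
  apply: diff_derivable; apply: Ck_differentiable Up.
  exact: Ck_mdot oU (smooth_dv 1) (smooth_dv 1).
have e1 : 'D_w (fun q => mdot (xu q) (xu q)) p =
    - 'D_w (fun q => mdot (xv q) (xv q)) p.
  apply: etrans (deriveN dvv); apply: near_eq_derive.
  apply: open_near_eq oU Up _ => q Uq; rewrite mdot_xu.
  by rewrite -[LHS]opprK -mdot_xv.
have e2 : 'D_w (fun q => mdot (xu q) (xv q)) p = 0.
  rewrite -[RHS](derive_cst (0 : R) p w); apply: near_eq_derive.
  by apply: open_near_eq oU Up _ => q Uq; exact: mdot_xu_xv.
move: e1 e2; rewrite uu vv uv; move: ('D_w xu p) ('D_w xv p) (xu p) (xv p).
move=> a b c d; rewrite (mdotC c a) (mdotC d b) (mdotC c b) => e1 e2; split=> //.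
move: (mdot a c) (mdot b d) e1 => r s e1; apply/eqP.
(* Differentiating a square doubles the term, and the factor 2 is cancelled here. *)
rewrite -(mulrI_eq0 _ (mulfI (_ : 2 != 0))) ?pnatr_eq0 //; apply/eqP.
by transitivity (r + r + (s + s)); [ring | rewrite e1 addNr].
Qed.

Lemma PhiE p : Phi x p = dvec (xu p) (xv p).
Proof. by rewrite /Phi -xuE -xvE vreal_dj. Qed.

(** As j^2 = 1, x_vv joins the real part; the j-part is the mean of two equal mixed derivatives. *)
Lemma d_dt_PhiE p : U p ->
  d_dt (Phi x) p = dvec (2^-1 *: (xuu p + xvv p)) (xuv p).
Proof.
move=> Up; rewrite /d_dt /d_du_dnum /d_dv_dnum.
have -> : (fun q => vRe (Phi x q)) = xu by apply/funext => q; rewrite PhiE vRe_dvec.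
have -> : (fun q => vIm (Phi x q)) = xv by apply/funext => q; rewrite PhiE vIm_dvec.
rewrite -xuuE -xuvE -xvvE d_du_xv // !vreal_dj; move: (xuu p) (xuv p) (xvv p) => a b c.
by apply/rowP => i; rewrite !mxE; congr Double => /=; rewrite ?mxE; field.
Qed.

Lemma minimal_curvature_formulas p : U p -> mean_curvature x p = 0 ->
  gauss_curvature x p
    = - (4 * vnorm2 (dnormal_proj x p (d_dt (Phi x) p)) / vnorm2 (Phi x p) ^+ 2)
  /\
  gauss_curvature x p
    = - (4 * wedge_norm2 (Phi x p) (d_dt (Phi x) p) / vnorm2 (Phi x p) ^+ 3).
Proof.
move=> Up H0; have vvE := minimal_norp Up H0.
rewrite (minimal_gauss_curvature Up vvE) dnormal_projE // d_dt_PhiE // PhiE.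
rewrite vRe_dvec vIm_dvec.
have [] := derive_metric (1, 0) Up; have [] := derive_metric (0, 1) Up.
rewrite !derive_xu // !derive_xv //= !scale0r !scale1r !add0r !addr0.
move: vvE (metricE_neq0 Up) (mdot_xu p) (mdot_xv Up) (mdot_xu_xv Up).
move: (xu p) (xv p) (xuu p) (xuv p) (xvv p) (E p) => a b A B C e.
move=> nC e0 aa bb ab r1 r2 r3 r4.
exact: normal_part_formulas.
Qed.

End IsothermalSurface.

Theorem mainTheorem6 (R : realType) (n : nat) (D : set (R * R))
    (x : R * R -> 'rV[R]_n)
    (x_timelike : timelike_surface x D)
    (x_isothermal : isothermal x D)
    (E_lt0 : forall p, D p -> metricE x p < 0)
    (x_minimal : minimal x D) :
  forall p, D p ->
    gauss_curvature x p
      = - (4 * vnorm2 (dnormal_proj x p (d_dt (Phi x) p)) / vnorm2 (Phi x p) ^+ 2)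
    /\
    gauss_curvature x p
      = - (4 * wedge_norm2 (Phi x p) (d_dt (Phi x) p) / vnorm2 (Phi x p) ^+ 3).
Proof.
move=> p Dp; have [[oD _ _] x_smooth _ _] := x_timelike.
exact: (minimal_curvature_formulas erefl erefl erefl erefl erefl erefl
  oD x_smooth x_isothermal E_lt0 Dp (x_minimal p Dp)).
Qed.
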